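(* Let $J:\mathcal{X}\to[0,\infty]$ be a convex one-homogeneous functional on the real Banach space $\mathcal{X}$. For $u,v\in\mathcal{X}$ and a subgradient $p(v)\in\partial J(v)$ set $$[u,v]_J^{p(v)} := \langle u,p(v)\rangle\, J(v),$$ and let $\{[u,v]_J\}:=\{\langle u,p\rangle J(v) : p\in\partial J(v)\}$ be the corresponding set of admissible values. Then this is a semi-inner-product of $J$ with full homogeneity, i.e. for all $u,u_1,u_2,v\in\mathcal{X}$ and $\alpha\in\mathbb{R}$, where $[\cdot,\cdot]_J$ stands for an arbitrary element of the corresponding set $\{[\cdot,\cdot]_J\}$: 1. (Linearity in the first argument) $[u_1+u_2,v]_J=s+q$ for some $s\in\{[u_1,v]_J\}$ and $q\in\{[u_2,v]_J\}$; 2. (Homogeneity in the first argument) $[\alpha u,v]_J\in\{\alpha[u,v]_J\}$; 3. (Functional-inducing) $[u,u]_J=J^2(u)$; 4. (Cauchy-Schwarz-type inequality) $\sqrt{|[u,v]_J\,[v,u]_J|}\le J(u)J(v)$; 5. (Homogeneity in the second argument) $[u,\alpha v]_J\in\{\alpha[u,v]_J\}$.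
   Context: $\mathcal{X}$ is a real Banach space (of functions) with dual $\mathcal{X}^*$; $\langle\cdot,\cdot\rangle$ denotes the $L^2$ inner product, used as the pairing between $\mathcal{X}$ and $\mathcal{X}^*$. $J:\mathcal{X}\to[0,\infty]$ is proper, convex and lower semi-continuous. One-homogeneous means $J(\alpha u)=|\alpha|J(u)$ for all $\alpha\in\mathbb{R}$, $u\in\mathcal{X}$. It is assumed throughout that $J(u)>0$ for $u\in\mathcal{X}\setminus\{0\}$. The subdifferential is $\partial J(u)=\{p\in\mathcal{X}^* : J(v)-J(u)\ge\langle p,v-u\rangle\ \forall v\in\mathcal{X}\}$; its elements are called subgradients and $p(u)$ denotes an element of $\partial J(u)$. The semi-inner-product of $J$ is allowed to be set-valued: $\{[u,v]_J\}$ denotes the set of admissible values and $[u,v]_J$ denotes an element of it; $\{\alpha[u,v]_J\}$ denotes $\{\alpha s : s\in\{[u,v]_J\}\}$. Statements about elements of a set are vacuous when the set is empty.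
   Formalization: In item 5 the case α = 0 is asserted only when {[u,v]_J} is nonempty; if ∂J(v) is empty (e.g. J(v) = ∞), then [u,0]_J = 0 exists while {0·[u,v]_J} is empty, so the literal membership fails. *)

(* Defs.v *)
From HB Require Import structures.
From mathcomp Require Export all_boot all_order all_algebra.
From mathcomp Require Export all_classical all_reals all_analysis.
Export Order.TTheory GRing.Theory Num.Theory.
Export numFieldNormedType.Exports.

Set Implicit Arguments.
Unset Strict Implicit.
Unset Printing Implicit Defensive.

Local Open Scope classical_set_scope.
Local Open Scope ring_scope.
Local Open Scope ereal_scope.

Section functionals.
Context (R : realType) (X : normedModType R).
Implicit Types (J : X -> \bar R) (u v : X).

(* Properness of a functional that is already known to avoid -oo. *)
Definition proper_functional J := exists u, J u < +oo.

(* In [\bar R], 0 * +oo = 0, so the endpoints t = 0 and t = 1 are trivial. *)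
Definition convex_functional J :=
  forall u v (t : R), (0 <= t <= 1)%R ->
    J (t *: u + (1 - t) *: v)%R <= t%:E * J u + (1 - t)%:E * J v.

Definition one_homogeneous J :=
  forall (alpha : R) u, J (alpha *: u)%R = `|alpha|%:E * J u.

(* The dual space is the set of continuous linear forms, paired with X by
   evaluation. No p qualifies where J u = +oo: there J v - J u = -oo for
   every v (in [\bar R], +oo - +oo = -oo). *)
Definition subdifferential J u : set {linear X -> R^o} :=
  [set p | continuous p /\
     forall v, (p (v - u)%R : R)%:E <= J v - J u].

(* Finite whenever J >= 0 and p is a subgradient of J at v. *)
Definition sip_at J (p : {linear X -> R^o}) u v : \bar R :=
  (p u : R)%:E * J v.

Definition sip J u v : set (\bar R) :=
  [set sip_at J p u v | p in subdifferential J v].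

Definition sip_scale (alpha : R) (S : set (\bar R)) : set (\bar R) :=
  [set alpha%:E * s | s in S].

End functionals.

(* Main.v *)
Require Import Defs.
From mathcomp Require Import lra.

(** A subgradient of a one-homogeneous functional is nothing but a continuous
    linear form [p] that lies below [J] everywhere and touches it at [v]
    ([subdifferential_homogeneousP]).  Testing the subgradient inequality at
    [0] and at [2v] gives [p v = J v]; the inequality then loses its dependence
    on the base point.  As [J] is even, the bound [p <= J] improves to
    [`|p| <= J] ([subgradient_norm_le]).

    Everything follows from these two facts.  A subgradient exists at [v] only
    if [J v] is finite, so the first two claims are the linearity of [p], free
    of indeterminate forms; the third is [p u = J u]; the fourth bounds each
    of the two pairings by [J].  For the fifth, the sign of [alpha] moves from
    the point to the subgradient: if [p] is a subgradient at [alpha v], then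
    [sg alpha * p] is one at [v] ([subgradient_sg]).  This needs
    [alpha <> 0]; for [alpha = 0] both products vanish because [J 0 = 0]. *)

Set Implicit Arguments.
Unset Strict Implicit.
Unset Printing Implicit Defensive.

Local Open Scope classical_set_scope.
Local Open Scope ring_scope.
Local Open Scope ereal_scope.

Section one_homogeneous_subgradients.
Context (R : realType) (X : normedModType R).
Implicit Types (J : X -> \bar R) (p : {linear X -> R^o}) (u v w : X).

Lemma one_homogeneous0 J : one_homogeneous J -> J 0%R = 0.
Proof. by move=> hJ; rewrite -(scale0r 0%R) hJ normr0 mul0e. Qed.

Lemma one_homogeneousN J v : one_homogeneous J -> J (- v)%R = J v.
Proof. by move=> hJ; rewrite -scaleN1r hJ normrN1 mul1e. Qed.

(** Where [J v] is infinite, [J 0 - J v] is [-oo] and [p (- v)] cannot lie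
    below it. *)
Lemma subgradient_fin_num J p v : (forall u, 0 <= J u) -> one_homogeneous J ->
  subdifferential J v p -> J v \is a fin_num.
Proof.
move=> J0 hJ [_ /(_ 0%R)]; rewrite (one_homogeneous0 hJ) add0e.
by have := J0 v; case: (J v).
Qed.

(** Geometrically: the epigraph of [J] is a cone, so a hyperplane supporting it
    at [(v, J v)] passes through the apex. *)
Lemma subdifferential_homogeneousP J p v :
  (forall u, 0 <= J u) -> one_homogeneous J ->
  subdifferential J v p <->
  [/\ continuous p, J v = (p v : R)%:E & forall w, (p w : R)%:E <= J w].
Proof.
move=> J0 hJ; split=> [vp|[cp pv pJ]]; last first.
  by split=> // w; rewrite pv linearB EFinB leeB.
have Jvfin := subgradient_fin_num J0 hJ vp.
have [a Ja] : exists a, J v = a%:E by exists (fine (J v)); rewrite fineK.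
case: vp => cp vp; rewrite Ja in vp *.
have pv : a = p v.
  apply/eqP; rewrite eq_le; apply/andP; split.
    have := vp 0%R; rewrite (one_homogeneous0 hJ) sub0r linearN add0e.
    by rewrite -EFinN lee_fin lerN2.
  have := vp (2%:R *: v)%R; rewrite hJ Ja ger0_norm//.
  rewrite -EFinM -EFinB lee_fin linearB linearZ /= => h.
  by have : (2 * (p v : R) - p v <= 2 * a - a)%R := h; lra.
split=> // [|w]; first by rewrite pv.
have := vp w; rewrite pv linearB EFinB; case: (J w) (J0 w) => [x||]//= _.
  by rewrite -!EFinB !lee_fin lerD2r.
by move=> _; rewrite leey.
Qed.

Lemma subgradient_norm_le J p v w : (forall u, 0 <= J u) -> one_homogeneous J ->
  subdifferential J v p -> `|(p w : R)|%:E <= J w.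
Proof.
move=> J0 hJ /(subdifferential_homogeneousP _ _ J0 hJ)[_ _ pJ].
have [_|_] := ger0P (p w : R); first exact: pJ.
by have := pJ (- w)%R; rewrite (one_homogeneousN _ hJ) linearN.
Qed.

(** Evenness of [J] makes the set of linear forms dominated by [J] symmetric,
    and [sg alpha] is the sign with which the form attains [J v] at [v]. *)
Lemma subgradient_sg J p v (alpha : R) :
  (forall u, 0 <= J u) -> one_homogeneous J -> alpha != 0%R ->
  subdifferential J (alpha *: v)%R p ->
  subdifferential J v (Num.sg alpha \*: p : {linear X -> R^o}).
Proof.
move=> J0 hJ a0 vp; apply/(subdifferential_homogeneousP _ _ J0 hJ).
have pJ w := subgradient_norm_le w J0 hJ vp.
have [cp pv _] := (subdifferential_homogeneousP _ _ J0 hJ).1 vp.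
split => [x||w].
- by apply: cvgZr; exact: cp.
- rewrite -[in LHS](scalerK a0 v) hJ pv -EFinM linearZ /=; congr EFin.
  rewrite [LHS]mulrA; congr (_ * _)%R.
  by rewrite normfV {2}[alpha]numEsg mulrCA mulVf ?normr_eq0// mulr1.
- apply: le_trans (pJ w); rewrite lee_fin.
  apply: le_trans (ler_norm _) _.
  by rewrite [X in (X <= _)%R]normrM normr_sg a0 mul1r.
Qed.

End one_homogeneous_subgradients.

Theorem theorem1 (R : realType) (X : completeNormedModType R)
    (J : X -> \bar R)
    (J_ge0 : forall u : X, 0 <= J u)
    (J_proper : proper_functional J)
    (J_convex : convex_functional J)
    (J_lsc : lower_semicontinuous J)
    (J_hom : one_homogeneous J)
    (J_pos : forall u : X, u <> 0%R -> 0 < J u) :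
  (forall (u1 u2 v : X) (r : \bar R), sip J (u1 + u2)%R v r ->
     exists s q : \bar R, [/\ sip J u1 v s, sip J u2 v q & r = s + q]) /\
  (forall (u v : X) (alpha : R) (r : \bar R), sip J (alpha *: u)%R v r ->
     sip_scale alpha (sip J u v) r) /\
  (forall (u : X) (r : \bar R), sip J u u r -> r = J u ^+ 2) /\
  (forall (u v : X) (r s : \bar R), sip J u v r -> sip J v u s ->
     sqrte `|r * s| <= J u * J v) /\
  (forall (u v : X) (alpha : R) (r : \bar R), sip J u (alpha *: v)%R r ->
     (alpha = 0%R -> sip J u v !=set0) ->
     sip_scale alpha (sip J u v) r).
Proof.
have Jfin v p := @subgradient_fin_num R X J p v J_ge0 J_hom.
have subP p v := @subdifferential_homogeneousP R X J p v J_ge0 J_hom.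
split; [|split; [|split; [|split]]].
- move=> u1 u2 v _ [p vp <-].
  exists (sip_at J p u1 v), (sip_at J p u2 v); split; try by exists p.
  by rewrite /sip_at linearD EFinD muleDl// (Jfin _ _ vp).
- move=> u v alpha _ [p vp <-]; exists (sip_at J p u v); first by exists p.
  by rewrite /sip_at linearZ /= EFinM muleA.
- by move=> u _ [p /subP[_ pu _] <-]; rewrite /sip_at -pu expe2.
- move=> u v _ _ [p vp <-] [q uq <-]; rewrite /sip_at.
  have := subgradient_norm_le u J_ge0 J_hom vp.
  have := subgradient_norm_le v J_ge0 J_hom uq.
  have := J_ge0 u; have := J_ge0 v.
  rewrite -(fineK (Jfin _ _ vp)) -(fineK (Jfin _ _ uq)) -!EFinM /= !lee_fin.
  move: (fine (J v)) (fine (J u)) => b a b0 a0 qv pu.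
  rewrite -[leRHS]ger0_norm ?mulr_ge0// -[leRHS]sqrtr_sqr ler_wsqrtr//.
  rewrite !normrM (ger0_norm a0) (ger0_norm b0) expr2 mulrACA (mulrC b).
  by rewrite ler_wpM2r ?mulr_ge0 ?ler_pM.
- move=> u v alpha _ [p vp <-]; have [->|a0 _] := eqVneq alpha 0%R.
    move=> /(_ erefl)[s vs]; exists s => //.
    by rewrite mul0e /sip_at scale0r (one_homogeneous0 J_hom) mule0.
  exists (sip_at J (Num.sg alpha \*: p : {linear X -> R^o}) u v).
    by exists (Num.sg alpha \*: p : {linear X -> R^o}) => //; exact: subgradient_sg.
  rewrite /sip_at J_hom !muleA -!EFinM; congr (_%:E * _).
  have -> : (Num.sg alpha \*: p : {linear X -> R^o}) u = (Num.sg alpha * (p u : R))%R by [].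
  by rewrite normrEsg mulrC mulrAC [RHS]mulrC.
Qed.
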